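(* Let $X$ be a super-reflexive Banach space. Then $X$ has the fixed point property for $\mathfrak{cm}$-nonexpansive maps: for every nonempty bounded closed convex $C\subset X$, every $\mathfrak{cm}$-nonexpansive map $T\colon C\to C$ has a fixed point.
   Context: $X$ is super-reflexive if every Banach space finitely representable in $X$ is reflexive. For a bounded convex set $C$, a nonexpansive map $T\colon C\to C$ is $\mathfrak{cm}$-nonexpansive if for all $n\in\mathbb{N}$, $y\in C$ and sequences $(u_i)_{i=1}^\infty\subset C$: $\limsup_{i\to\infty}\sup_{A\subset\{1,\dots,n\}}\|\sum_{k\in A}(Tu_{i+k}-Ty)\|\le\limsup_{i\to\infty}\sup_{A\subset\{1,\dots,n\}}\|\sum_{k\in A}(u_{i+k}-y)\|$. *)

(* Defs.v *)
From HB Require Import structures.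
From mathcomp Require Import all_boot all_order all_algebra.
From mathcomp Require Import all_classical all_reals all_analysis.
Set Implicit Arguments. Unset Strict Implicit. Unset Printing Implicit Defensive.
Import Order.TTheory GRing.Theory Num.Theory.
Import numFieldNormedType.Exports.
Local Open Scope classical_set_scope.
Local Open Scope ring_scope.

Section Defs.
Variable R : realType.

Definition bdd_lin_with {X : normedModType R} (f : X -> R) (c : R) : Prop :=
  [/\ 0 <= c,
      (forall x y, f (x + y) = f x + f y),
      (forall (a : R) x, f (a *: x) = a * f x) &
      (forall x, `|f x| <= c * `|x|)].

Definition bdd_lin {X : normedModType R} (f : X -> R) : Prop :=
  exists c, bdd_lin_with f c.

(* Phi is an element of the bidual X^** : linear on X^*, and
   |Phi f| <= M ||f|| (expressed through every admissible bound c of ||f||). *)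
Definition bidual_elt {X : normedModType R} (Phi : (X -> R) -> R) : Prop :=
  [/\ (forall f g, bdd_lin f -> bdd_lin g -> Phi (f \+ g) = Phi f + Phi g),
      (forall (a : R) f, bdd_lin f -> Phi (fun x => a * f x) = a * Phi f) &
      (exists M, forall f c, bdd_lin_with f c -> `|Phi f| <= M * c)].

Definition reflexive (X : normedModType R) : Prop :=
  forall Phi : (X -> R) -> R, bidual_elt Phi ->
    exists x : X, forall f, bdd_lin f -> Phi f = f x.

Definition span_of {Y : normedModType R} (n : nat) (v : 'I_n -> Y) : set Y :=
  [set y | exists c : 'I_n -> R, y = \sum_(i < n) c i *: v i].

(* Y is finitely representable in X: for every finite-dimensional subspace E
   of Y and every eps > 0 there is a linear isomorphism T of E onto a subspace
   of X with ||T|| ||T^{-1}|| < 1 + eps, i.e. a ||y|| <= ||T y|| <= b ||y||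
   on E with 0 < a and b / a < 1 + eps. *)
Definition fin_rep (Y X : normedModType R) : Prop :=
  forall (n : nat) (v : 'I_n -> Y) (eps : R), 0 < eps ->
    exists (T : Y -> X) (a b : R),
      [/\ (forall y z, span_of v y -> span_of v z -> T (y + z) = T y + T z),
          (forall (t : R) y, span_of v y -> T (t *: y) = t *: T y),
          0 < a, b / a < 1 + eps &
          (forall y, span_of v y -> a * `|y| <= `|T y| /\ `|T y| <= b * `|y|)].

Definition super_reflexive (X : completeNormedModType R) : Prop :=
  forall Y : completeNormedModType R, fin_rep Y X -> reflexive Y.

Definition bounded_set_norm {X : normedModType R} (C : set X) : Prop :=
  exists M : R, forall x, C x -> `|x| <= M.

Definition convex_set_R {X : normedModType R} (C : set X) : Prop :=
  forall x y (t : R), C x -> C y -> 0 <= t -> t <= 1 ->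
    C (t *: x + (1 - t) *: y).

Definition nonexpansive_on {X : normedModType R} (C : set X) (T : X -> X) :=
  forall x y, C x -> C y -> `|T x - T y| <= `|x - y|.

Definition cm_quant {X : normedModType R} (n : nat) (u : nat -> X) (y : X)
    (i : nat) : R :=
  \big[Num.max/0]_(A : {set 'I_n}) `| \sum_(k in A) (u (i + k.+1)%N - y) |.

(* cm-nonexpansive map T : C -> C (T given as a map on X, only its values on
   C matter) *)
Definition cm_nonexpansive {X : normedModType R} (C : set X) (T : X -> X) :=
  [/\ (forall x, C x -> C (T x)),
      nonexpansive_on C T &
      (forall (n : nat) (y : X) (u : nat -> X), C y -> (forall i, C (u i)) ->
        (limn_esup (fun i => (cm_quant n (T \o u) (T y) i)%:E)
         <= limn_esup (fun i => (cm_quant n u y i)%:E))%E)].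

End Defs.

(* Main.v *)
(**
  Let [x_i] be approximate fixed points of [T], let [x] be their weak limit along
  a free ultrafilter on [nat], and put [y_i = x_i - x].

  Fix [theta > 0].  If for every [N] the norm-one functionals that are
  [>= theta] on [N] of the [y_i] at once persisted along the ultrafilter, then,
  since the [y_i] are weakly null, one could choose, for every [N], vectors
  [z_i] and functionals [f_j] ([i, j < N]) with [f_j z_i >= theta] for [i <= j]
  and [f_j z_i <= theta / 2] for [j < i].  Such systems pass to an ultrapower of
  [X], which is finitely representable in [X], and contradict its reflexivity.

  So for some [N] there is a sequence [u] among the [x_i] such that no norm-one
  functional is [>= theta] on [N] of the [u_i - x].  Norming functionals then bound
  [sum_(k in A) (u_(i+k) - x)], for [A] a subset of [{1..n}], by
  [N * sup |y_i| + n * theta].  Hence the means of [u] are close to [x], so that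
  [x] belongs to [C]; and the cm-inequality at [y = x] gives
  [n |x - T x| <= 2 N sup |y_i| + 2 n theta + o(1)] for every [n] and [theta].
*)

Require Import Defs.
From HB Require Import structures.
From mathcomp Require Import all_boot all_order all_algebra.
From mathcomp Require Import all_classical all_reals all_analysis.
From mathcomp Require Import ring lra.
Set Implicit Arguments. Unset Strict Implicit. Unset Printing Implicit Defensive.
Import Order.TTheory GRing.Theory Num.Theory.
Import numFieldNormedType.Exports.
Local Open Scope classical_set_scope.
Local Open Scope ring_scope.

(** * Norming functionals *)

Definition sublinear {R : realType} {V : lmodType R} (p : V -> R) : Prop :=
  (forall x y, p (x + y) <= p x + p y) /\
  (forall a x, 0 < a -> p (a *: x) <= a * p x).

Section Sublinear.
Variables (R : realType) (V : lmodType R).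
Implicit Types p q : V -> R.

Lemma sublinear0 p : sublinear p -> p 0 = 0.
Proof.
move=> [_ ph]; have := ph 2 0 (ltr0Sn _ 1); have := ph (2^-1) 0.
by rewrite !scaler0 invr_gt0 ltr0Sn => /(_ isT); lra.
Qed.

Lemma sublinear_opp p x : sublinear p -> - p (- x) <= p x.
Proof. by move=> sp; have := sp.1 x (- x); rewrite subrr sublinear0 //; lra. Qed.

Lemma sublinearZ p a x : sublinear p -> 0 < a -> p (a *: x) = a * p x.
Proof.
move=> sp a0; apply/eqP; rewrite eq_le sp.2 //=.
have := sp.2 a^-1 (a *: x); rewrite invr_gt0 => /(_ a0).
by rewrite scalerA mulVf ?gt_eqF // scale1r ler_pdivlMl.
Qed.

(** Subadditivity and homogeneity are asked of [Q] as a family, with another member [k] on the left.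
    This fits both the family in [sublinear_lower] and the chains of Zorn's lemma. *)
Lemma sublinear_inf (Q : set (V -> R)) :
  Q !=set0 ->
  (forall x, exists c, forall g, Q g -> c <= g x) ->
  (forall g h x y, Q g -> Q h -> exists2 k, Q k & k (x + y) <= g x + h y) ->
  (forall g a x, Q g -> 0 < a -> exists2 k, Q k & k (a *: x) <= a * g x) ->
  let q := fun x => inf [set g x | g in Q] in
  sublinear q /\ forall g x, Q g -> q x <= g x.
Proof.
move=> [g0 Qg0] lbQ QD QZ q.
have qle g x : Q g -> q x <= g x.
  move=> Qg; apply: ge_inf; last by exists g.
  by have [c cP] := lbQ x; exists c => _ [h Qh <-]; exact: cP.
have q_ge x c : (forall g, Q g -> c <= g x) -> c <= q x.
  by move=> cP; apply: lb_le_inf; [exists (g0 x), g0|move=> _ [h Qh <-]; exact: cP].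
split=> [|g x]; last exact: qle.
split=> [x y|a x a0].
  suff : q (x + y) - q x <= q y by rewrite lerBlDl.
  apply: (q_ge) => h Qh; suff : q (x + y) - h y <= q x by lra.
  apply: (q_ge) => g Qg; have [k Qk] := QD g h x y Qg Qh.
  by have := qle k (x + y) Qk; lra.
suff : a^-1 * q (a *: x) <= q x by rewrite ler_pdivrMl.
apply: (q_ge) => g Qg; rewrite ler_pdivrMl //.
by have [k Qk] := QZ g a x Qg a0; apply: le_trans; exact: qle.
Qed.

(* The functional [x |-> inf_(t >= 0) (q (x + t y) - t q y)] is the largest
   sublinear functional below [q] that is linear on the line through [y]. *)
Lemma sublinear_lower q y : sublinear q ->
  exists q', [/\ sublinear q', (forall x, q' x <= q x) &
                 (forall x, q' x + q y <= q (x + y))].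
Proof.
move=> sq; pose Q := [set g : V -> R |
  exists2 t, 0 <= t & g = fun x => q (x + t *: y) - t * q y].
have qt t : 0 <= t -> q (t *: y) = t * q y.
  rewrite le_eqVlt => /predU1P[<-|t0]; last exact: sublinearZ.
  by rewrite scale0r mul0r sublinear0.
have [||||sq' q'le] := @sublinear_inf Q.
- by exists (fun x => q (x + 0 *: y) - 0 * q y), 0.
(* A lower bound, because [t * q y = q (t *: y) <= q (x + t *: y) + q (- x)]. *)
- move=> x; exists (- q (- x)) => _ [t t0 ->].
  have := sq.1 (x + t *: y) (- x); rewrite [x + _]addrC addrK qt //; lra.
- move=> _ _ x z [t t0 ->] [s s0 ->].
  exists (fun x => q (x + (t + s) *: y) - (t + s) * q y).
    by exists (t + s) => //; exact: addr_ge0.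
  have := sq.1 (x + t *: y) (z + s *: y); rewrite addrACA -scalerDl; lra.
- move=> _ a x [t t0 ->] a0.
  exists (fun x => q (x + (a * t) *: y) - (a * t) * q y).
    by exists (a * t) => //; rewrite mulr_ge0 // ltW.
  by rewrite -scalerA -scalerDr sublinearZ // mulrBr mulrA.
eexists; split; [exact: sq'|move=> x|move=> x].
- have := q'le _ x (ex_intro2 _ _ 0 (lexx 0) erefl : Q _).
  by rewrite scale0r mul0r addr0 subr0.
- have := q'le _ x (ex_intro2 _ _ 1 ler01 erefl : Q _).
  by rewrite scale1r mul1r -lerBrDr.
Qed.

(** Zorn's lemma with the order reversed: a chain is bounded by its pointwise infimum, which is
    finite since every sublinear [q <= p] satisfies [- p (- x) <= - q (- x) <= q x]. *)
Lemma sublinear_minimal p : sublinear p ->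
  exists q, [/\ sublinear q, (forall x, q x <= p x) &
    forall q', sublinear q' -> (forall x, q' x <= q x) -> forall x, q x <= q' x].
Proof.
move=> sp; pose S := {q : V -> R | sublinear q /\ forall x, q x <= p x}.
pose le_S (s t : S) := `[< forall x, sval t x <= sval s x >].
have p0 : S by exists p.
have [//|||[q [sq qp]] qmin] := @ZL_preorder S p0 le_S.
- by move=> t; apply/asboolP.
- move=> r s t /asboolP rs /asboolP st; apply/asboolP => x.
  exact: le_trans (rs x).
- move=> A Atot; have [[s0 As0]|A0] := pselect (A !=set0); last first.
    by exists p0 => s As; case: A0; exists s.
  pose Q := [set sval s | s in A].
  have [||||sq qle] := @sublinear_inf Q.
  + by exists (sval s0), s0.
  + move=> x; exists (- p (- x)) => _ [[s [ss sle]] _ <-] /=.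
    by apply: le_trans (sublinear_opp _ ss); rewrite lerN2.
  + move=> _ _ x y [s As <-] [t At <-].
    have [/asboolP st|/asboolP ts] := Atot _ _ As At.
      exists (sval t); first by exists t.
      by apply: le_trans ((svalP t).1.1 _ _) _; rewrite lerD2r.
    exists (sval s); first by exists s.
    by apply: le_trans ((svalP s).1.1 _ _) _; rewrite lerD2l.
  + move=> _ a x [s As <-] a0; exists (sval s); first by exists s.
    exact: (svalP s).1.2.
  have qp x : inf [set g x | g in Q] <= p x.
    by apply: le_trans ((svalP s0).2 x); apply: qle; exists s0.
  exists (exist (fun q => sublinear q /\ forall x, q x <= p x) _ (conj sq qp)).
  move=> s As; apply/asboolP => x /=.
  by apply: qle; exists s.
exists q; split => // q' sq' q'q.
have q'p x : q' x <= p x by exact: le_trans (q'q x) (qp x).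
have := qmin (exist (fun q => sublinear q /\ _) q' (conj sq' q'p)) (asboolT q'q).
by move/asboolP.
Qed.

(* A minimal sublinear functional is unchanged by [sublinear_lower], hence
   superadditive, hence linear. *)
Lemma sublinear_dominates_linear p : sublinear p ->
  exists f : V -> R, [/\ (forall x y, f (x + y) = f x + f y),
    (forall a x, f (a *: x) = a * f x) & (forall x, f x <= p x)].
Proof.
move=> /sublinear_minimal[q [sq qp qmin]].
have qD x y : q (x + y) = q x + q y.
  apply/eqP; rewrite eq_le sq.1 /=.
  have [q' [sq' q'q q'D]] := sublinear_lower y sq.
  by apply: le_trans (q'D x); rewrite lerD2r; exact: qmin.
have qN x : q (- x) = - q x.
  by apply/eqP; rewrite -addr_eq0 -qD addNr sublinear0.
exists q; split => // a x; have [a0|a0|->] := ltgtP a 0.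
- have Na0 : 0 < - a by rewrite oppr_gt0.
  by have := sublinearZ x sq Na0; rewrite scaleNr qN mulNr => /oppr_inj.
- exact: sublinearZ.
- by rewrite scale0r mul0r sublinear0.
Qed.

End Sublinear.

(** The norm is first lowered along [x0] to [p] with [p x + |x0| <= |x + x0|]. At [x = - x0] this
    forces [f (- x0) <= - |x0|] for every linear [f <= p]. *)
Lemma norming_functional {R : realType} {X : normedModType R} (x0 : X) :
  exists2 f : X -> R, bdd_lin_with f 1 & f x0 = `|x0|.
Proof.
have sN : sublinear (fun x : X => `|x|).
  split=> [x y|a x a0]; first exact: ler_normD.
  by rewrite normrZ gtr0_norm.
have [p [sp pN pD]] := sublinear_lower x0 sN.
have [f [fD fZ fp]] := sublinear_dominates_linear sp.
have fN x : f (- x) = - f x by rewrite -scaleN1r fZ mulN1r.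
have fle x : f x <= `|x| by exact: le_trans (fp x) (pN x).
exists f.
  split => // x; rewrite mul1r ler_norml fle andbT.
  by rewrite lerNl -fN -(normrN x).
apply/eqP; rewrite eq_le fle /=.
by have := pD (- x0); have := fp (- x0); rewrite addNr normr0 fN /=; lra.
Qed.

(** * Limits along a free ultrafilter *)

Lemma free_ultrafilter_exists :
  {U : set_system nat | UltraFilter U /\ \oo `<=` U}.
Proof. by apply: cid; exact: ultraFilterLemma. Qed.

Definition free_ultrafilter : set_system nat := sval free_ultrafilter_exists.
Local Notation U := free_ultrafilter.

Instance free_ultrafilter_ultra : UltraFilter U.
Proof. exact: (svalP free_ultrafilter_exists).1. Qed.

Lemma free_ultrafilter_ge n : \forall k \near U, (n <= k)%N.
Proof. by apply: (svalP free_ultrafilter_exists).2; exact: nbhs_infty_ge. Qed.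

Lemma not_nearU (P : set nat) : ~ U P -> U (~` P).
Proof. by have [|//] := in_ultra_setVsetC P free_ultrafilter_ultra. Qed.

Lemma ultra_fmap {T T' : Type} (f : T -> T') (F : set_system T) :
  UltraFilter F -> UltraFilter (f @ F).
Proof.
move=> FU; split => [|G GP FG]; first exact: fmap_proper_filter.
apply/seteqP; split => // A GA.
have [//|FA] := in_ultra_setVsetC (f @^-1` A) FU.
have GcA : G (~` A) by exact: FG.
by have := filter_ex (filterI GA GcA) => -[x []].
Qed.

Definition bounded_seq {R : realType} {X : normedModType R} (a : nat -> X) :=
  exists M : R, forall i, `|a i| <= M.

Section UltraLimit.
Variable R : realType.
Implicit Types u v : nat -> R.

Definition ulim u : R := lim (u @ U).

Lemma ulim_eq u (l : R) : u @ U --> l -> ulim u = l.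
Proof. by move=> ul; apply/cvg_lim. Qed.

(** An ultrafilter on the compact segment [[-M, M]] converges. *)
Lemma cvg_ulim u M : (forall i, `|u i| <= M) -> u @ U --> ulim u.
Proof.
move=> uM; have := @segment_compact R (- M) M; rewrite compact_ultra.
move=> /(_ (u @ U) (ultra_fmap _ _))[|l [_ ul]]; last first.
  by rewrite (ulim_eq ul).
by apply: nearW => i /=; rewrite in_itv /= -ler_norml.
Qed.

Lemma cvgU_unique u (l l' : R) : u @ U --> l -> u @ U --> l' -> l = l'.
Proof. by move=> /ulim_eq <- /ulim_eq. Qed.

Lemma cvgU_le u v (l l' : R) : u @ U --> l -> v @ U --> l' ->
  (forall i, u i <= v i) -> l <= l'.
Proof. by move=> ul vl uv; apply: (ler_cvg_to ul vl); exact: nearW. Qed.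

End UltraLimit.

(** * Pairing of bounded sequences with sequences of functionals *)

Section UltrapowerPairing.
Variables (R : realType) (X : normedModType R).
Implicit Types a b : nat -> X.

Definition functional_seq :=
  {g : nat -> X -> R | forall i, bdd_lin_with (g i) 1}.

Lemma functional_seq_le (g : functional_seq) i x : `|sval g i x| <= `|x|.
Proof. by have [_ _ _ /(_ x)] := svalP g i; rewrite mul1r. Qed.

Lemma functional_seqD (g : functional_seq) i x y :
  sval g i (x + y) = sval g i x + sval g i y.
Proof. by have [_ + _ _] := svalP g i; exact. Qed.

Lemma functional_seqZ (g : functional_seq) i c x :
  sval g i (c *: x) = c * sval g i x.
Proof. by have [_ _ + _] := svalP g i; exact. Qed.

(** With values in [R^o] these functions form a left module, of which the ultrapower will be a
    submodule. *)
Definition ultra_pairing a : functional_seq -> R^o :=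
  fun g => ulim (fun i => sval g i (a i)).

Lemma cvg_ultra_pairing a g : bounded_seq a ->
  sval g i (a i) @[i --> U] --> (ultra_pairing a g : R).
Proof.
move=> [M aM]; apply: (@cvg_ulim _ _ M) => i.
exact: le_trans (functional_seq_le _ _ _) (aM i).
Qed.

Lemma bounded_seqD a b : bounded_seq a -> bounded_seq b -> bounded_seq (a \+ b).
Proof.
move=> [M aM] [N bN]; exists (M + N) => i /=.
by apply: le_trans (ler_normD _ _) _; exact: lerD.
Qed.

Lemma bounded_seqZ c a : bounded_seq a -> bounded_seq (c \*: a).
Proof.
by move=> [M aM]; exists (`|c| * M) => i /=; rewrite normrZ ler_wpM2l.
Qed.

Lemma ultra_pairingD a b : bounded_seq a -> bounded_seq b ->
  ultra_pairing (a \+ b) = ultra_pairing a + ultra_pairing b.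
Proof.
move=> ab bb; apply/funext => g; apply: ulim_eq.
under eq_fun do rewrite functional_seqD.
by apply: cvgD; exact: cvg_ultra_pairing.
Qed.

Lemma ultra_pairingZ c a : bounded_seq a ->
  ultra_pairing (c \*: a) = c *: ultra_pairing a.
Proof.
move=> ab; apply/funext => g; apply: ulim_eq.
under eq_fun do rewrite functional_seqZ.
by apply: cvgMl_tmp; exact: cvg_ultra_pairing.
Qed.

Lemma cvg_norm_ulim a : bounded_seq a ->
  `|a i| @[i --> U] --> ulim (fun i => `|a i|).
Proof. by move=> [M aM]; apply: (@cvg_ulim _ _ M) => i; rewrite normr_id. Qed.

Lemma ultra_pairing_norming a : bounded_seq a ->
  exists g, ultra_pairing a g = ulim (fun i => `|a i|).
Proof.
move=> ab.
have /choice[g gP] i : exists f, bdd_lin_with f 1 /\ f (a i) = `|a i|.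
  by have [f] := norming_functional (a i); exists f.
exists (exist (fun g => forall i, bdd_lin_with (g i) 1) g (fun i => (gP i).1)).
apply: ulim_eq; under eq_fun do rewrite /= (gP _).2.
exact: cvg_norm_ulim.
Qed.

End UltrapowerPairing.

(** * The ultrapower *)

Section Ultrapower.
Variables (R : realType) (X : normedModType R).
Local Notation pairing := (@ultra_pairing R X).
Implicit Types a b : nat -> X.

(* By Hahn-Banach, two bounded sequences have the same pairing iff their
   difference tends to 0 along the ultrafilter, so the pairings form the
   ultrapower. *)
Definition ultrapower_pred : {pred functional_seq X -> R^o} :=
  fun phi => `[< exists2 a, bounded_seq a & phi = pairing a >].

Lemma ultrapower_submod : submod_closed ultrapower_pred.
Proof.
split.
  apply/asboolP; exists (fun=> 0); first by exists 0 => i; rewrite normr0.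
  apply/funext => g; apply/esym/ulim_eq.
  under eq_fun do rewrite -(scale0r (0 : X)) functional_seqZ mul0r.
  exact: cvg_cst.
move=> c _ _ /asboolP[a ab ->] /asboolP[b bb ->]; apply/asboolP.
exists (c \*: a \+ b); first by apply: bounded_seqD => //; exact: bounded_seqZ.
by rewrite ultra_pairingD ?ultra_pairingZ //; exact: bounded_seqZ.
Qed.

HB.instance Definition _ :=
  GRing.isSubmodClosed.Build R (functional_seq X -> R^o) ultrapower_pred
    ultrapower_submod.

Record ultrapower := Ultrapower {
  ultrapower_val : functional_seq X -> R^o;
  _ : ultrapower_val \in ultrapower_pred }.

HB.instance Definition _ := [isSub for ultrapower_val].
HB.instance Definition _ := [Choice of ultrapower by <:].
HB.instance Definition _ := [SubChoice_isSubLmodule of ultrapower by <:].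

Implicit Types x y z : ultrapower.

Definition represents a y := bounded_seq a /\ val y = pairing a.

Lemma represents_ex y : exists a, represents a y.
Proof. by case: y => phi /= /[dup] /asboolP[a ab ->]; exists a. Qed.

Lemma represented_ex a : bounded_seq a -> exists y, represents a y.
Proof.
move=> ab; have aP : pairing a \in ultrapower_pred by apply/asboolP; exists a.
by exists (Ultrapower aP).
Qed.

Lemma representsD a b x y : represents a x -> represents b y ->
  represents (a \+ b) (x + y).
Proof.
move=> [ab xa] [bb yb]; split; first exact: bounded_seqD.
by rewrite raddfD /= xa yb ultra_pairingD.
Qed.

Lemma representsZ c a x : represents a x -> represents (c \*: a) (c *: x).
Proof.
move=> [ab xa]; split; first exact: bounded_seqZ.
by rewrite linearZ /= xa ultra_pairingZ.
Qed.

Lemma representsB a b x y : represents a x -> represents b y ->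
  represents (fun i => a i - b i) (x - y).
Proof.
move=> xa yb; rewrite -scaleN1r.
rewrite (_ : (fun i => _) = a \+ (-1) \*: b).
  by apply: representsD => //; exact: representsZ.
by apply/funext => i /=; rewrite scaleN1r.
Qed.

Lemma represents0_norm a : represents a 0 -> `|a i| @[i --> U] --> (0 : R).
Proof.
move=> [ab a0]; have [g] := ultra_pairing_norming ab.
by rewrite -a0 linear0 /= => /esym; have := cvg_norm_ulim ab => /[swap] ->.
Qed.

Definition ultrapower_norm y : R := ulim (fun i => `|sval (cid (represents_ex y)) i|).

(** The chosen representative does not matter: two of them differ by a sequence representing 0,
    whose norms tend to 0 along the ultrafilter. *)
Lemma represents_norm a y : represents a y ->
  `|a i| @[i --> U] --> ultrapower_norm y.
Proof.
move=> ya; rewrite /ultrapower_norm; case: cid => b /= yb.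
have le_norm c d : represents c y -> represents d y ->
    ulim (fun i => `|c i|) <= ulim (fun i => `|d i|).
  move=> yc yd; have := representsB yc yd; rewrite subrr => cd0.
  have dcvg := cvgD (represents0_norm cd0) (cvg_norm_ulim yd.1).
  rewrite add0r in dcvg.
  apply: (cvgU_le (cvg_norm_ulim yc.1) (dcvg _)) => i.
  by rewrite -[c i in X in X <= _](subrK (d i)) ler_normD.
have -> : ulim (fun i => `|b i|) = ulim (fun i => `|a i|).
  by apply/eqP; rewrite eq_le !le_norm.
exact: cvg_norm_ulim ya.1.
Qed.

Lemma ultrapower_normD x y :
  ultrapower_norm (x + y) <= ultrapower_norm x + ultrapower_norm y.
Proof.
have [a xa] := represents_ex x; have [b yb] := represents_ex y.
apply: (cvgU_le (represents_norm (representsD xa yb))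
  (cvgD (represents_norm xa) (represents_norm yb))) => i.
exact: ler_normD.
Qed.

Lemma ultrapower_normZ c x :
  ultrapower_norm (c *: x) = `|c| * ultrapower_norm x.
Proof.
have [a xa] := represents_ex x.
apply: cvgU_unique (represents_norm (representsZ c xa)) _.
under eq_fun do rewrite /= normrZ.
by apply: cvgMl_tmp; exact: represents_norm.
Qed.

Lemma pairing_le_norm g x : `|val x g : R| <= ultrapower_norm x.
Proof.
have [a xa] := represents_ex x; rewrite xa.2.
have gcvg : `|sval g i (a i)| @[i --> U] --> `|pairing a g : R|.
  by apply: cvg_norm; exact: cvg_ultra_pairing xa.1.
apply: (cvgU_le gcvg (represents_norm xa)) => i.
exact: functional_seq_le.
Qed.

Lemma ultrapower_norm_eq0 x : ultrapower_norm x = 0 -> x = 0.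
Proof.
move=> x0; apply/val_inj/funext => g; rewrite linear0.
by apply/eqP; rewrite -normr_le0 -x0; exact: pairing_le_norm.
Qed.

HB.instance Definition _ := Lmodule_isNormed.Build R ultrapower
  ultrapower_normD ultrapower_normZ ultrapower_norm_eq0.

Lemma cvg_represents_norm a y : represents a y -> `|a i| @[i --> U] --> `|y|.
Proof. exact: represents_norm. Qed.

(* Diagonal sequence: at [i] use the representative of [y_ k] for the largest
   [k <= i] up to which the representatives are close at [i]. *)
Lemma ultrapower_complete (F : set_system ultrapower) :
  ProperFilter F -> cauchy F -> cvg F.
Proof.
move=> FF /cauchyP Fc; pose r n : R := n.+1%:R^-1.
have r0 n : 0 < r n by rewrite invr_gt0.
have r_le n m : (n <= m)%N -> r m <= r n by move=> nm; rewrite lef_pV2 ?posrE ?ler_nat.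
have /choice[y yP] n : exists y, F (ball y (r n)) by exact: Fc.
have yd n m : `|y n - y m| < r n + r m.
  have [z []] := filter_ex (filterI (yP n) (yP m)).
  rewrite -!ball_normE /= [`|y m - z|]distrC => nz mz.
  by apply: le_lt_trans (ler_distD z _ _) _; exact: ltrD.
have /choice[a aP] n : exists a, represents a (y n) by exact: represents_ex.
pose good k i := forall n m, (n <= k)%N -> (m <= k)%N ->
  `|a n i - a m i| <= r n + r m.
have good0 i : good 0 i.
  move=> n m; rewrite !leqn0 => /eqP -> /eqP ->.
  by rewrite subrr normr0 addr_ge0 // ltW.
have /choice[k kP] i : exists k, good k i /\
    forall n, (n <= i)%N -> good n i -> (n <= k)%N.
  have ex : exists k, (k <= i)%N && `[< good k i >] by exists 0; apply/asboolP.
  have ub n : (n <= i)%N && `[< good n i >] -> (n <= i)%N by move=> /andP[].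
  case: (ex_maxnP ex ub) => k /andP[_ /asboolP gk] kmax.
  by exists k; split => // n ni gn; apply: kmax; rewrite ni; apply/asboolP.
(* Only finitely many pairs are involved, and for each the limit [|y p - y q|] of the distances lies
   strictly below [r p + r q]. *)
have near_good n : \forall i \near U, good n i.
  have near_pair p q : \forall i \near U, `|a p i - a q i| <= r p + r q.
    have := cvg_represents_norm (representsB (aP p) (aP q)).
    by move=> /cvgr_le; apply; exact: yd.
  have : \forall i \near U, forall p : 'I_n.+1 * 'I_n.+1,
      `|a p.1 i - a p.2 i| <= r p.1 + r p.2.
    by apply: filter_forall => p; exact: near_pair.
  apply: filterS => i ip p q pn qn.
  by have := ip (@Ordinal n.+1 p pn, @Ordinal n.+1 q qn).
have near_k n : \forall i \near U, (n <= k i)%N.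
  near=> i; apply: (kP i).2; near: i; first exact: free_ultrafilter_ge.
  exact: near_good.
pose b i := a (k i) i.
have bb : bounded_seq b.
  have [M aM] := (aP 0).1; exists (M + (r 0 + r 0)) => i.
  rewrite /b -[a _ i](subrK (a 0 i)) addrC.
  apply: le_trans (ler_normD _ _) _; apply: lerD => //.
  apply: le_trans ((kP i).1 _ _ (leqnn _) (leq0n _)) _.
  by rewrite lerD2r r_le.
have [z zb] := represented_ex bb.
have zy n : `|z - y n| <= r n + r n.
  apply: cvgr_to_le (cvg_represents_norm (representsB zb (aP n))) _.
  near=> i; have nk : (n <= k i)%N by near: i; exact: near_k.
  by apply: le_trans ((kP i).1 _ _ (leqnn _) nk) _; rewrite lerD2r r_le.
apply/cvg_ex; exists z; apply/cvgrPdist_lt => e e0 /=.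
have [n ne] : exists n, r n + r n + r n < e.
  have e3 : 0 < e / 3 by rewrite divr_gt0.
  have [n _ nP] := near_infty_natSinv_lt (PosNum e3).
  by exists n; have := nP n (leqnn n); rewrite /= -/(r n); lra.
apply: filterS (yP n) => x; rewrite -ball_normE /= => yx.
apply: lt_trans ne; apply: le_lt_trans (ler_distD (y n) _ _) _.
exact: ler_ltD.
Unshelve. all: by end_near. Qed.

HB.instance Definition _ :=
  Uniform_isComplete.Build ultrapower ultrapower_complete.

End Ultrapower.

(** * Finite representability of the ultrapower *)

Section LinearSpan.
Variables (R : realType) (V : lmodType R).

(** Vectors and coefficients are indexed by [nat], so that [d] can vary without casts between
    ordinals. *)
Definition lin_comb (d : nat) (w : nat -> V) (c : nat -> R) : V :=
  \sum_(j < d) c j *: w j.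

Lemma lin_combD d w c c' :
  lin_comb d w (fun j => c j + c' j) = lin_comb d w c + lin_comb d w c'.
Proof. by rewrite -big_split; apply: eq_bigr => j _; rewrite scalerDl. Qed.

Lemma lin_combZ d w t c :
  lin_comb d w (fun j => t * c j) = t *: lin_comb d w c.
Proof. by rewrite scaler_sumr; apply: eq_bigr => j _; rewrite scalerA. Qed.

Lemma lin_combB d w c c' :
  lin_comb d w (fun j => c j - c' j) = lin_comb d w c - lin_comb d w c'.
Proof.
rewrite -scaleN1r -lin_combZ -lin_combD; congr lin_comb.
by apply/funext => j; rewrite mulN1r.
Qed.

Definition lin_free d w := forall c, lin_comb d w c = 0 ->
  forall j, (j < d)%N -> c j = 0.

Lemma lin_free_inj d w c c' : lin_free d w ->
  lin_comb d w c = lin_comb d w c' -> forall j, (j < d)%N -> c j = c' j.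
Proof.
move=> fw cc' j jd; apply/eqP; rewrite -subr_eq0; apply/eqP.
by apply: (fw (fun j => c j - c' j)) => //; rewrite lin_combB cc' subrr.
Qed.

Lemma eq_lin_comb d w w' c c' :
  (forall j, (j < d)%N -> c j = c' j /\ w j = w' j) ->
  lin_comb d w c = lin_comb d w' c'.
Proof. by move=> e; apply: eq_bigr => j _; have [-> ->] := e j (ltn_ord j). Qed.

Lemma lin_basis_ex n (v : nat -> V) : exists d w, lin_free d w /\
  forall i, (i < n)%N -> exists c, v i = lin_comb d w c.
Proof.
elim: n => [|n [d [w [fw wv]]]].
  by exists 0, (fun=> 0); split => // c _ j; rewrite ltn0.
have [[c vn]|vn] := pselect (exists c, v n = lin_comb d w c).
  exists d, w; split => // i; rewrite ltnS leq_eqVlt => /predU1P[->|/wv //].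
  by exists c.
pose w' j := if (j < d)%N then w j else v n.
have w'E c : lin_comb d.+1 w' c = lin_comb d w c + c d *: v n.
  rewrite /lin_comb big_ord_recr /= {2}/w' ltnn; congr (_ + _).
  by apply: eq_bigr => j _; rewrite /w' ltn_ord.
exists d.+1, w'; split=> [c|i].
  rewrite w'E => c0; have cd : c d = 0.
    (* With [c d] nonzero the relation could be solved for [v n]. *)
    apply: contrapT => /eqP cd; apply: vn; exists (fun j => - (c d)^-1 * c j).
    apply: (scalerI cd); rewrite lin_combZ scalerA mulrN divff // scaleN1r.
    by apply/eqP; rewrite -addr_eq0 addrC c0.
  move=> j; rewrite ltnS leq_eqVlt => /predU1P[->//|jd].
  by apply: fw jd; rewrite -c0 cd scale0r addr0.
rewrite ltnS leq_eqVlt => /predU1P[->|/wv[c ->]].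
  exists (fun j => (j == d)%:R); rewrite w'E eqxx scale1r.
  rewrite /lin_comb big1 ?add0r // => j _.
  by rewrite (ltn_eqF (ltn_ord j)) scale0r.
exists (fun j => if (j < d)%N then c j else 0).
rewrite w'E ltnn scale0r addr0; apply: eq_lin_comb => j jd.
by rewrite jd.
Qed.

End LinearSpan.

Lemma lin_comb_norm_le (R : realType) (V : normedModType R) d (w : nat -> V) c
    (K : nat -> R) : (forall j, (j < d)%N -> `|w j| <= K j) ->
  `|lin_comb d w c| <= \sum_(j < d) `|c j| * K j.
Proof.
move=> wK; apply: le_trans (ler_norm_sum _ _ _) _; apply: ler_sum => j _.
by rewrite normrZ ler_wpM2l // wK.
Qed.

Lemma span_of_lin_comb (R : realType) (V : normedModType R) n (v : 'I_n -> V) :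
  exists d w, lin_free d w /\
    forall y, span_of v y -> exists c, y = lin_comb d w c.
Proof.
pose v' i := oapp v 0 (insub i : option 'I_n).
have [d [w [fw wv]]] := lin_basis_ex n v'; exists d, w; split => // _ [c ->].
apply: (big_ind (fun y => exists c, y = lin_comb d w c)) => [|x y [cx ->] [cy ->]|i _].
- by exists (fun=> 0 * 0); rewrite lin_combZ scale0r.
- by exists (fun j => cx j + cy j); rewrite lin_combD.
- have [b vb] := wv i (ltn_ord i); exists (fun j => c i * b j).
  by rewrite lin_combZ -vb /v' valK.
Qed.

Lemma cvgU_sum (R : realType) d (f : nat -> nat -> R) (l : nat -> R) :
  (forall j, (j < d)%N -> f j k @[k --> U] --> l j) ->
  \sum_(j < d) f j k @[k --> U] --> \sum_(j < d) l j.
Proof.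
elim: d => [|d IH] fl.
  by under eq_fun do rewrite big_ord0; rewrite big_ord0; exact: cvg_cst.
under eq_fun do rewrite big_ord_recr; rewrite big_ord_recr.
by apply: cvgD; [apply: IH => j jd; exact/fl/ltnW|exact: fl].
Qed.

Section UltrapowerFinRep.
Variables (R : realType) (X : normedModType R).
Variables (d : nat) (w : nat -> ultrapower X) (a : nat -> nat -> X).
Hypothesis aw : forall j, represents (a j) (w j).

Lemma represents_lin_comb c :
  represents (fun k => lin_comb d (a^~ k) c) (lin_comb d w c).
Proof.
rewrite /lin_comb; elim: d => [|e IH].
  rewrite big_ord0; have := representsB (aw 0) (aw 0); rewrite subrr.
  by congr represents; apply/funext => k; rewrite big_ord0 subrr.
have := representsD IH (representsZ (c e) (aw e)).
rewrite big_ord_recr; congr represents.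
by apply/funext => k; rewrite big_ord_recr.
Qed.

(* Otherwise normalised coefficients violating the estimate at almost every
   [k] would converge along the ultrafilter to a nontrivial relation
   between the [w j]. *)
Lemma ultrapower_near_isometry (delta : R) : lin_free d w -> 0 < delta ->
  \forall k \near U, forall c,
    `| `|lin_comb d (a^~ k) c| - `|lin_comb d w c| | <=
      delta * `|lin_comb d w c|.
Proof.
move=> fw delta0; pose P k := forall c,
  `| `|lin_comb d (a^~ k) c| - `|lin_comb d w c| | <=
    delta * `|lin_comb d w c|.
change (U P); apply: contrapT => /not_nearU nP.
(* Where the estimate fails, a violating [c] is divided by its l1 norm [s]. Elsewhere only the bound
   by 1 is recorded, so that coefficients have limits along the ultrafilter. *)
have /choice[c cP] k : exists c : nat -> R,
    (forall j, (j < d)%N -> `|c j| <= 1) /\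
    (~ P k -> \sum_(j < d) `|c j| = 1 /\
      delta * `|lin_comb d w c| <=
        `| `|lin_comb d (a^~ k) c| - `|lin_comb d w c| |).
  have [Pk|/existsNP[c /negP]] := pselect (P k).
    by exists (fun=> 0); split => // j _; rewrite normr0.
  rewrite -ltNge => cP; pose s := \sum_(j < d) `|c j|.
  have s_ge0 : 0 <= s by apply: sumr_ge0.
  have s0 : 0 < s.
    rewrite lt_neqAle s_ge0 andbT eq_sym; apply/eqP => /eqP.
    rewrite psumr_eq0 // => /allP c0; move: cP.
    have lc0 (V : lmodType R) (u : nat -> V) : lin_comb d u c = 0.
      rewrite /lin_comb big1 // => j _.
      have := c0 j (mem_index_enum _); rewrite /= normr_eq0 => /eqP ->.
      by rewrite scale0r.
    by rewrite !lc0 !normr0 subrr normr0 mulr0 ltxx.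
  exists (fun j => s^-1 * c j); split=> [j jd|_].
    rewrite normrM gtr0_norm ?invr_gt0 // mulrC ler_pdivrMr // mul1r /s.
    by rewrite (bigD1 (Ordinal jd)) //= lerDl sumr_ge0.
  split.
    rewrite -[RHS](divff (lt0r_neq0 s0)) mulrC mulr_sumr.
    by apply: eq_bigr => j _; rewrite normrM gtr0_norm ?invr_gt0.
  rewrite !lin_combZ !normrZ -mulrBr normrM normr_id mulrCA.
  by rewrite ler_wpM2l // ltW.
have /choice[M aM] j : exists M : R, forall k, `|a j k| <= M.
  by have [[M aM] _] := aw j; exists M.
pose l j := ulim (fun k => c k j).
(* A common bound for [w j] and all [a j k]; the summand 1 makes [e k] dominate the l1 distance from
   [c k] to [l] as well. *)
pose K j := `|w j| + M j + 1.
have M0 j : 0 <= M j by apply: le_trans (aM j 0).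
pose e k := \sum_(j < d) `|c k j - l j| * K j.
have e0 : e k @[k --> U] --> (0 : R).
  have -> : 0 = \sum_(j < d) `|l j - l j| * K j :> R.
    by rewrite big1 // => j _; rewrite subrr normr0 mul0r.
  apply: (@cvgU_sum R d (fun j k => `|c k j - l j| * K j)
    (fun j => `|l j - l j| * K j)) => j jd.
  apply: cvgMr_tmp; apply: cvg_norm; apply: cvgB; last exact: cvg_cst.
  by apply: (@cvg_ulim _ _ 1) => k; exact: (cP k).1.
have le_e (V : normedModType R) (u : nat -> V) k :
    (forall j, `|u j| <= K j) ->
    `| `|lin_comb d u (c k)| - `|lin_comb d u l| | <= e k.
  move=> uK; apply: le_trans (ler_dist_dist _ _) _.
  by rewrite -lin_combB; exact: lin_comb_norm_le.
have wK j : `|w j| <= K j by rewrite /K; have := M0 j; lra.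
have aK k j : `|a j k| <= K j.
  by rewrite /K; have := aM j k; have := normr_ge0 (w j); lra.
(* Replacing [c k] by its limit [l] in the violated estimate costs at most [e k * (delta + 2)], so
   [delta * |lin_comb d w l| <= f k], and [f k] tends to 0. *)
have Wl0 : `|lin_comb d w l| <= 0.
  pose f k := e k * (delta + 2) +
    `| `|lin_comb d (a^~ k) l| - `|lin_comb d w l| |.
  have f0 : f k @[k --> U] --> (0 : R).
    rewrite (_ : 0 = 0 * (delta + 2) +
       `| `|lin_comb d w l| - `|lin_comb d w l| |); last first.
      by rewrite subrr normr0 mul0r addr0.
    apply: cvgD; first exact: cvgMr_tmp.
    apply: cvg_norm; apply: cvgB; last exact: cvg_cst.
    exact: cvg_represents_norm (represents_lin_comb l).
  rewrite -(pmulr_rle0 _ delta0); apply: cvgr_to_ge f0 _.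
  apply: filterS nP => k /= /(cP k).2[_].
  have := le_e _ w k wK; have := le_e _ (a^~ k) k (aK k); rewrite /f.
  move: (e k) `|lin_comb d w l| `|lin_comb d w (c k)|
    `|lin_comb d (a^~ k) l| `|lin_comb d (a^~ k) (c k)|.
  move=> E Wl Wc Al Ac h1 h2 h3.
  have h4 : `|Ac - Wc| <= `|Ac - Al| + `|Al - Wl| + `|Wc - Wl|.
    have := ler_normD (Ac - Al + (Al - Wl)) (Wl - Wc).
    have := ler_normD (Ac - Al) (Al - Wl).
    rewrite [`|Wc - Wl|]distrC.
    have -> : Ac - Al + (Al - Wl) + (Wl - Wc) = Ac - Wc by lra.
    lra.
  have h5 : delta * Wl <= delta * Wc + delta * E.
    rewrite -mulrDr ler_pM2l //.
    by move: h2; rewrite ler_norml => /andP[+ _]; lra.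
  nra.
have l0 j : (j < d)%N -> l j = 0.
  by apply: fw; apply/eqP; rewrite -normr_le0.
(* As [l] vanishes, [e k] is at least the l1 norm of [c k], which is 1 for almost every [k]. *)
suff : (1 : R) <= 0 by rewrite ler10.
apply: cvgr_to_ge e0 _; apply: filterS nP => k /= /(cP k).2[<- _].
apply: ler_sum => j _; rewrite l0 // subr0 -[X in X <= _]mulr1 ler_wpM2l //.
by rewrite /K; have := M0 j; have := normr_ge0 (w j); lra.
Qed.

End UltrapowerFinRep.

(** A combination of basis vectors of the span is sent to the same combination of the [k]-th terms
    of their representatives, at one [k] where this is nearly isometric. *)
Lemma fin_rep_ultrapower (R : realType) (X : normedModType R) :
  fin_rep (ultrapower X) X.
Proof.
move=> n v eps eps0; have [d [w [fw wv]]] := span_of_lin_comb v.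
have /choice[a aw] j : exists a, represents a (w j) by exact: represents_ex.
(* Then [(1 + delta) / (1 - delta) = 1 + 2 / 3 * eps]. *)
pose delta := eps / (3 + eps).
have delta0 : 0 < delta by rewrite divr_gt0 // addr_gt0.
have [k kP] := filter_ex (ultrapower_near_isometry aw fw delta0).
(* On the span these coordinates are unique because [w] is free, which makes the map linear
   there. *)
have /choice[c cP] y : exists c, span_of v y -> y = lin_comb d w c.
  have [/wv[c ->]|ny] := pselect (span_of v y); first by exists c.
  by exists (fun=> 0).
exists (fun y => lin_comb d (a^~ k) (c y)), (1 - delta), (1 + delta); split.
- move=> y z vy vz; rewrite -lin_combD; apply: eq_lin_comb => j jd; split => //.
  apply: (@lin_free_inj _ _ d w _ (fun j => c y j + c z j) fw _ j jd).
  rewrite lin_combD -!cP //.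
  have [cy ->] := vy; have [cz ->] := vz; exists (fun i => cy i + cz i).
  by rewrite -big_split; apply: eq_bigr => i _; rewrite scalerDl.
- move=> t y vy; rewrite -lin_combZ; apply: eq_lin_comb => j jd; split => //.
  apply: (@lin_free_inj _ _ d w _ (fun j => t * c y j) fw _ j jd).
  rewrite lin_combZ -!cP //.
  have [cy ->] := vy; exists (fun i => t * cy i).
  by rewrite scaler_sumr; apply: eq_bigr => i _; rewrite scalerA.
- rewrite subr_gt0 /delta ltr_pdivrMr ?addr_gt0 //; lra.
- have e3 : 3 + eps != 0 by rewrite gt_eqF // addr_gt0.
  rewrite (_ : _ / _ = 1 + 2 / 3 * eps); first lra.
  by rewrite /delta; field; rewrite e3 /=; lra.
- move=> y vy; have := kP (c y); rewrite -cP // ler_norml; lra.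
Qed.

(** * Weak limits and James systems *)

(** The limit of [f (x i)] is linear and bounded in [f], hence an element of the bidual, and
    reflexivity represents it by a point. *)
Lemma reflexive_weak_ulim (R : realType) (X : normedModType R) (x : nat -> X) :
  Defs.reflexive X -> bounded_seq x ->
  exists z, forall f, bdd_lin f -> f (x i) @[i --> U] --> (f z : R).
Proof.
move=> rX [M xM]; pose Phi (f : X -> R) : R := ulim (fun i => f (x i)).
have M0 : 0 <= M by apply: le_trans (xM 0).
have fM f c : bdd_lin_with f c -> forall i, `|f (x i)| <= M * c.
  move=> [c0 _ _ fc] i; apply: le_trans (fc _) _.
  by rewrite mulrC ler_wpM2r.
have cvgPhi f : bdd_lin f -> f (x i) @[i --> U] --> Phi f.
  by move=> [c /fM]; exact: cvg_ulim.
have [|z zP] := rX Phi.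
  split.
  - by move=> f g /cvgPhi fl /cvgPhi gl; apply: ulim_eq; exact: cvgD.
  - by move=> c f /cvgPhi fl; apply: ulim_eq; exact: cvgMl_tmp.
  - exists M => f c fc; have fl := cvgPhi _ (ex_intro _ c fc).
    by apply: cvgr_to_le (cvg_norm fl) _; apply: nearW; exact: fM fc.
by exists z => f fb; rewrite -zP //; exact: cvgPhi.
Qed.

Lemma super_reflexive_reflexive (R : realType) (X : completeNormedModType R) :
  super_reflexive X -> Defs.reflexive X.
Proof.
apply=> n v eps eps0; exists id, 1, 1; split => //.
  by rewrite divr1 ltrDl.
by move=> y _; rewrite mul1r.
Qed.

(* James' criterion. In the ultrapower the finite systems become one infinite
   system [e i], [F j]; if [w] is the weak limit of [e], then [F j w <= theta / 2]
   for every [j], whereas the limit [G] of the [F j] satisfies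
   [theta <= G (e i)] for every [i], hence [theta <= G w]. *)
Lemma super_reflexive_no_james_systems
    (R : realType) (X : completeNormedModType R) (theta M : R) :
  super_reflexive X -> 0 < theta ->
  ~ (forall N, exists (x : nat -> X) (f : nat -> X -> R),
      [/\ forall i, `|x i| <= M, forall j, bdd_lin_with (f j) 1,
          forall i j, (i <= j < N)%N -> theta <= f j (x i) &
          forall i j, (j < i < N)%N -> f j (x i) <= theta / 2]).
Proof.
move=> sX theta0 /choice[x /choice[f xf]].
have rY : Defs.reflexive (ultrapower X).
  exact: (sX (ultrapower X : completeNormedModType R) (@fin_rep_ultrapower R X)).
have bx i : bounded_seq (x^~ i) by exists M => N; have [+ _ _ _] := xf N; exact.
(* The [i]-th vectors of all the systems, read as a sequence in [N], represent one element [e i];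
   the [j]-th functionals likewise give [F j]. *)
have /choice[e eP] i : exists y, represents (x^~ i) y by exact: represented_ex.
pose g j : functional_seq X := exist (fun g => forall i, bdd_lin_with (g i) 1)
  (f^~ j) (fun N => let: And4 _ fb _ _ := xf N in fb j).
pose F j (y : ultrapower X) : R := val y (g j).
have F1 j : bdd_lin_with (F j) 1.
  by split => // y; rewrite mul1r; exact: pairing_le_norm.
have cvgFe j i : f N j (x N i) @[N --> U] --> F j (e i).
  by rewrite /F (eP i).2; exact: (@cvg_ultra_pairing _ _ _ (g j) (bx i)).
(* The [N]-th system guarantees this only for [N > j], that is for almost every [N]. *)
have Fe_ge i j : (i <= j)%N -> theta <= F j (e i).
  move=> ij; apply: cvgr_to_ge (cvgFe j i) _.
  apply: filterS (free_ultrafilter_ge j.+1) => N jN.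
  by have [_ _ + _] := xf N; apply; rewrite ij.
have Fe_le i j : (j < i)%N -> F j (e i) <= theta / 2.
  move=> ji; apply: cvgr_to_le (cvgFe j i) _.
  apply: filterS (free_ultrafilter_ge i.+1) => N iN.
  by have [_ _ _] := xf N; apply; rewrite ji.
have eb : bounded_seq e.
  exists M => i; apply: cvgr_to_le (cvg_represents_norm (eP i)) _.
  by apply: nearW => N; have [+ _ _ _] := xf N; exact.
have [w wP] := reflexive_weak_ulim rY eb.
pose G y := ulim (F^~ y).
have cvgG y : F j y @[j --> U] --> G y.
  by apply: (@cvg_ulim _ _ `|y|) => j; have [_ _ _ /(_ y)] := F1 j; rewrite mul1r.
have G1 : bdd_lin_with G 1.
  split => // [y z|c y|y].
  - by apply: ulim_eq; exact: (cvgD (cvgG y) (cvgG z)).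
  - by apply: ulim_eq; exact: (cvgMl_tmp (cvgG y)).
  - apply: cvgr_to_le (cvg_norm (cvgG y)) _; apply: nearW => j.
    by have [_ _ _] := F1 j; exact.
have Gw_ge : theta <= G w.
  apply: cvgr_to_ge (wP _ (ex_intro _ 1 G1)) _; apply: nearW => i.
  apply: cvgr_to_ge (cvgG (e i)) _.
  by apply: filterS (free_ultrafilter_ge i) => j; exact: Fe_ge.
have Gw_le : G w <= theta / 2.
  apply: cvgr_to_le (cvgG w) _; apply: nearW => j.
  apply: cvgr_to_le (wP _ (ex_intro _ 1 (F1 j))) _.
  by apply: filterS (free_ultrafilter_ge j.+1) => i; exact: Fe_le.
by move: (le_trans Gw_ge Gw_le); lra.
Qed.

(** * Selection along the ultrafilter *)

Section Selection.
Variable P : seq nat -> Prop.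

(** The newest term comes first, so earlier histories are final segments of later ones. *)
Fixpoint history (u : nat -> nat) n : seq nat :=
  if n is m.+1 then u m :: history u m else [::].

Lemma size_history u n : size (history u n) = n.
Proof. by elim: n => //= n ->. Qed.

Lemma drop_history u m n : (m <= n)%N -> drop (n - m) (history u n) = history u m.
Proof.
elim: n => [|n IH]; first by rewrite leqn0 => /eqP ->.
rewrite leq_eqVlt => /predU1P[->|]; first by rewrite subnn drop0.
by rewrite ltnS => mn; rewrite subSn //= IH.
Qed.

Lemma mem_history u i n : (i < n)%N -> u i \in history u n.
Proof.
elim: n => // n IH; rewrite ltnS leq_eqVlt inE => /predU1P[->|/IH ->].
  by rewrite eqxx.
by rewrite orbT.
Qed.

Lemma historyE u n : history u n = [seq u i | i <- rev (iota 0 n)].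
Proof.
by elim: n => // n IH; rewrite -addn1 iotaD add0n rev_cat /= -IH addn1.
Qed.

Lemma ultra_select (Q : seq nat -> nat -> Prop) :
  (forall h, \forall k \near U, Q h k) ->
  exists u : nat -> nat, forall n, Q (history u n) (u n).
Proof.
move=> nQ; have /choice[g gQ] h : exists k, Q h k by exact: filter_ex (nQ h).
pose H := fix H n := if n is m.+1 then g (H m) :: H m else [::].
exists (fun n => g (H n)) => n.
suff -> : history (fun n => g (H n)) n = H n by exact: gQ.
by elim: n => //= n ->.
Qed.

(** The [r]-fold iterated ultrafilter quantifier, used in the manner of Ramsey's theorem: if it
    fails at [s], it fails one level lower at [k :: s] for almost every [k]. *)
Fixpoint ultra_extends r s : Prop :=
  if r is q.+1 then \forall k \near U, ultra_extends q (k :: s) else P s.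

Lemma ultra_extends_sub r s : (forall k t, P (k :: t) -> P t) ->
  ultra_extends r s -> P s.
Proof.
move=> Psub; elim: r s => //= r IH s /filter_ex[k /IH]; exact: Psub.
Qed.

(** Each new index keeps the invariant that no subsequence of the history of length at most [N]
    extends, along the ultrafilter, to length [N]. At length [N] itself this says [~ P s]. *)
Lemma ultra_avoid N (S : set nat) : ~ ultra_extends N [::] -> U S ->
  exists u : nat -> nat, (forall n, S (u n)) /\
    forall n s, subseq s (history u n) -> size s = N -> ~ P s.
Proof.
move=> nN US.
have [h|u uP] := @ultra_select (fun h k => S k /\ forall s, subseq s h ->
    (size s < N)%N -> ~ ultra_extends (N - size s) s ->
    ~ ultra_extends (N - (size s).+1) (k :: s)).
  apply: filterI => //.
  (* Masks code the subsequences of [h]; being finitely many, their conditions can be met at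
     once. *)
  have : \forall k \near U, forall m : (size h).-tuple bool,
      (size (mask m h) < N)%N -> ~ ultra_extends (N - size (mask m h)) (mask m h) ->
      ~ ultra_extends (N - (size (mask m h)).+1) (k :: mask m h).
    apply: filter_forall => m; move: (mask m h) => s.
    have [sN|sN] := boolP (size s < N)%N; last by apply: nearW => k.
    have [//|ns] := pselect (ultra_extends (N - size s) s).
      by move=> sE; apply: nearW => k _ /(_ sE).
    move: (ns); rewrite -subnSK //= => /not_nearU; apply: filterS => k nk _ _.
    exact: nk.
  apply: filterS => k kP s /subseqP[m /eqP ms ->].
  exact: kP (Tuple ms).
exists u; split=> [n|]; first by have [] := uP n.
have avoid n s : subseq s (history u n) -> (size s <= N)%N ->
    ~ ultra_extends (N - size s) s.
  elim: n s => [|n IH] s; first by rewrite subseq0 => /eqP -> _; rewrite subn0.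
  case: s => [|k s] /=; first by rewrite subn0.
  case: eqP => [->|_] sh sN; last exact: IH.
  by apply: (uP n).2 => //; apply: IH => //; exact: ltnW.
by move=> n s sh sN; have := avoid n s sh; rewrite sN subnn; apply.
Qed.

End Selection.

(** * Functionals that are large on many terms of a weakly null sequence *)

Section WeaklyNull.
Variables (R : realType) (X : normedModType R) (y : nat -> X) (theta M : R).
Hypothesis y_le : forall i, `|y i| <= M.
Hypothesis y_weak0 : forall f, bdd_lin f -> f (y i) @[i --> U] --> (0 : R).
Hypothesis theta0 : 0 < theta.

Definition commonly_large (s : seq nat) : Prop :=
  exists2 f, bdd_lin_with f 1 & forall k, k \in s -> theta <= f (y k).

(** Indices are chosen one by one: extendability to length [N] is kept, while weak nullity makes the
    functionals of all histories so far at most [theta / 2] at the new vector. The [j]-th functional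
    belongs to the first [j + 1] indices. *)
Lemma commonly_large_james N : ultra_extends commonly_large N [::] ->
  exists (x : nat -> X) (f : nat -> X -> R),
    [/\ forall i, `|x i| <= M, forall j, bdd_lin_with (f j) 1,
        forall i j, (i <= j < N)%N -> theta <= f j (x i) &
        forall i j, (j < i < N)%N -> f j (x i) <= theta / 2].
Proof.
move=> extN.
have /choice[phi phiP] s : exists f, bdd_lin_with f 1 /\
    (commonly_large s -> forall k, k \in s -> theta <= f (y k)).
  have [[f f1 fs]|ns] := pselect (commonly_large s); first by exists f.
  by have [f f1 _] := norming_functional (0 : X); exists f.
have [h|u uP] := @ultra_select (fun h k =>
    ((size h < N)%N -> ultra_extends commonly_large (N - size h) h ->
      ultra_extends commonly_large (N - (size h).+1) (k :: h)) /\
    (* [drop j h] runs through [h] and all earlier histories. *)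
    forall j : 'I_(size h).+1, phi (drop j h) (y k) <= theta / 2).
  apply: filterI.
    have [hN|hN] := boolP (size h < N)%N; last by apply: nearW.
    have [|nh] := pselect (ultra_extends commonly_large (N - size h) h).
      by rewrite -subnSK //=; apply: filterS => k.
    by apply: nearW => k _ /nh.
  apply: filter_forall => j.
  have fl := y_weak0 (ex_intro _ 1 (phiP (drop j h)).1).
  by move/cvgr_le: fl; apply; rewrite divr_gt0.
have ext n : (n <= N)%N -> ultra_extends commonly_large (N - n) (history u n).
  elim: n => [|n IH] nN; first by rewrite subn0.
  by have := (uP n).1; rewrite size_history; apply => //; exact/IH/ltnW.
have large n : (n <= N)%N -> commonly_large (history u n).
  move=> /ext; apply: ultra_extends_sub => k t [f f1 ft]; exists f => // i it.
  by apply: ft; rewrite inE it orbT.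
exists (y \o u), (fun j => phi (history u j.+1)); split => //=.
- by move=> j; exact: (phiP _).1.
- move=> i j /andP[ij jN]; apply: (phiP (history u j.+1)).2; last exact: mem_history.
  exact: (large j.+1 jN).
- move=> i j /andP[ji _].
  have ji' : (i - j.+1 < (size (history u i)).+1)%N.
    by rewrite size_history ltnS leq_subr.
  by have := (uP i).2 (Ordinal ji'); rewrite /= drop_history.
Qed.

(* A functional norming the sum is at least [theta] on at most [N] of its
   terms. *)
Lemma sum_norm_le N (u : nat -> nat) :
  (forall n s, subseq s (history u n) -> size s = N -> ~ commonly_large s) ->
  forall n (A : {set 'I_n}) i,
    `|\sum_(k in A) y (u (i + k.+1)%N)| <= N%:R * M + n%:R * theta.
Proof.
move=> uP n A i; set v := \sum_(k in A) _.
have [f f1 fv] := norming_functional v; have [_ fD fZ fle] := f1.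
have f0 : f 0 = 0 by rewrite -(scale0r 0) fZ mul0r.
pose large j := theta <= f (y (u j)).
pose B := [set k : 'I_n | large (i + k.+1)%N]%SET.
have M0 : 0 <= M by apply: le_trans (y_le 0).
have cardB : (#|B| <= N)%N.
  (* Positions are counted, not values, as [u] may repeat; [i + n] is the last position in the sum.
     [N] large positions would give a forbidden subsequence of the history. *)
  pose t := [seq j <- iota 0 (i + n).+1 | large j].
  have tN : (size t < N)%N.
    rewrite ltnNge; apply/negP => Nt.
    apply: (uP (i + n).+1 [seq u j | j <- take N (rev t)]).
    - rewrite historyE; apply: map_subseq.
      apply: subseq_trans (take_subseq _ _) _.
      by rewrite -filter_rev; exact: filter_subseq.
    - by rewrite size_map size_take size_rev; case: ltngtP Nt.
    exists f => // _ /mapP[j /mem_take jt ->].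
    by move: jt; rewrite mem_rev mem_filter => /andP[].
  apply: leq_trans (ltnW tN).
  rewrite cardE -(size_map (fun k : 'I_n => (i + k.+1)%N)).
  apply: uniq_leq_size.
    rewrite map_inj_uniq ?enum_uniq // => a b /addnI/succn_inj ab.
    exact: val_inj.
  move=> _ /mapP[k + ->]; rewrite mem_enum finset.in_set => kB.
  by rewrite mem_filter kB mem_iota add0n ltnS leq_add2l ltn_ord.
rewrite -fv /v (big_morph f fD f0).
(* Each index contributes at most [theta], and at most [M] more if it lies in [B]. *)
apply: (@le_trans _ _ (\sum_(k < n) ((k \in B)%:R * M + theta))).
  rewrite big_mkcond; apply: ler_sum => k _; case: ifP => _; last first.
    by rewrite addr_ge0 ?mulr_ge0 // ltW.
  rewrite finset.in_set /large; case: (leP theta) => [_|/ltW]; last first.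
    by rewrite mul0r add0r.
  rewrite mul1r; have := le_trans (ler_norm _) (fle (y (u (i + k.+1)%N))).
  move=> /le_trans; apply; rewrite mul1r; apply: le_trans (y_le _) _.
  by rewrite lerDl ltW.
rewrite big_split /= -mulr_suml -natr_sum sumr_const card_ord.
rewrite -[theta *+ n]mulr_natl lerD2r ler_wpM2r // ler_nat.
by rewrite (leq_trans _ cardB) // -sum1_card [X in (_ <= X)%N]big_mkcond leq_sum.
Qed.

End WeaklyNull.

Lemma super_reflexive_small_sums
    (R : realType) (X : completeNormedModType R) (y : nat -> X) (theta M : R) :
  super_reflexive X -> (forall i, `|y i| <= M) ->
  (forall f, bdd_lin f -> f (y i) @[i --> U] --> (0 : R)) -> 0 < theta ->
  exists N : nat, forall S : set nat, U S ->
    exists u : nat -> nat, (forall n, S (u n)) /\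
      forall n (A : {set 'I_n}) i,
        `|\sum_(k in A) y (u (i + k.+1)%N)| <= N%:R * M + n%:R * theta.
Proof.
move=> sX yM y0 theta0.
have [N nN] : exists N, ~ ultra_extends (commonly_large y theta) N [::].
  apply/existsNP => ext.
  apply: (super_reflexive_no_james_systems (M := M) sX theta0) => N.
  exact: commonly_large_james (ext N).
exists N => S US; have [u [uS uP]] := ultra_avoid nN US.
by exists u; split => //; exact: sum_norm_le uP.
Qed.

(** * Fixed points *)

Lemma convex_set_mean (R : realType) (X : normedModType R) (C : set X)
    (u : nat -> X) n :
  convex_set_R C -> (forall i, C (u i)) ->
  C (n.+1%:R^-1 *: \sum_(k < n.+1) u k).
Proof.
move=> cC Cu; elim: n => [|n IH].
  by rewrite big_ord_recl big_ord0 addr0 invr1 scale1r.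
rewrite big_ord_recr /= scalerDr.
have n0 (m : nat) : m.+1%:R != 0 :> R by rewrite pnatr_eq0.
pose t : R := n.+1%:R / n.+2%:R.
have tE : 1 - t = n.+2%:R^-1.
  by apply: (mulIf (n0 n.+1)); rewrite mulVf // mulrBl mul1r divfK // -natrB // subSnn.
have -> : n.+2%:R^-1 *: (\sum_(k < n.+1) u k) =
    t *: (n.+1%:R^-1 *: \sum_(k < n.+1) u k).
  by rewrite scalerA /t mulrAC divff // mul1r.
rewrite -tE; apply: cC => //; first by rewrite divr_ge0.
by rewrite ler_pdivrMr // mul1r ler_nat.
Qed.

(** The map [g] is a contraction with factor [1 - t]; its fixed point [x] satisfies
    [T x - x = t *: (T x - z)]. *)
Lemma nonexpansive_approx_fixed_point (R : realType)
    (X : completeNormedModType R) (C : set X) (T : X -> X) (e : R) :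
  C !=set0 -> closed C -> bounded_set_norm C -> convex_set_R C ->
  (forall x, C x -> C (T x)) -> nonexpansive_on C T -> 0 < e ->
  exists2 x, C x & `|T x - x| <= e.
Proof.
move=> C0 clC [M CM] cC CT Tne e0; have [z Cz] := C0.
have M0 : 0 <= M by apply: le_trans (CM _ Cz).
(* Chosen so that [0 < t <= 1] and [t * (M + M) <= e]. *)
pose t := e / (e + (M + M)).
have s0 : 0 < e + (M + M) by lra.
have t0 : 0 < t by rewrite divr_gt0.
have t1 : t <= 1 by rewrite ler_pdivrMr //; lra.
pose g x := t *: z + (1 - t) *: T x.
have gC : set_fun C C g by move=> x Cx; apply: cC => //; [exact: CT|exact: ltW].
have q0 : 0 <= 1 - t by rewrite subr_ge0.
pose gf : {fun C >-> C} := HB.pack g (isFun.Build _ _ C C g gC).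
have [|x Cx xE] := @banach_fixed_point _ _ C gf _ clC C0.
  exists (NngNum q0); split; first by rewrite /= ltrBlDr ltrDl.
  move=> [x y] [/= Cx Cy].
  rewrite /g opprD addrACA subrr add0r -scalerBr normrZ ger0_norm //.
  by rewrite ler_wpM2l //; exact: Tne.
exists x => //; have -> : T x - x = t *: (T x - z).
  rewrite {2}xE /= /g scalerBl scale1r scalerBr opprD opprB.
  by rewrite [- _ + (_ - _)]addrC addrA [T x + _]addrC subrK.
rewrite normrZ gtr0_norm //.
apply: (@le_trans _ _ (t * (M + M))).
  apply: ler_wpM2l; first exact: ltW.
  apply: le_trans (ler_normB _ _) _.
  by apply: lerD; apply: CM => //; exact: CT.
by rewrite /t mulrAC ler_pdivrMr // ler_pM2l //; lra.
Qed.

Lemma limn_esup_le (R : realType) (a : nat -> \bar R) (c : \bar R) :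
  (forall i, a i <= c)%E -> (limn_esup a <= c)%E.
Proof.
move=> ac; apply: (@le_trans _ _ (ereal_sup (a @` setT))).
  by apply: ereal_inf_lbound; exists setT => //; exact: filterT.
by apply: ge_ereal_sup => _ [i _ <-].
Qed.

Lemma le_limn_esup (R : realType) (a : nat -> \bar R) (c : \bar R) :
  (forall i, c <= a i)%E -> (c <= limn_esup a)%E.
Proof.
move=> ca; apply: le_ereal_inf_tmp => _ [V /filter_ex[i Vi] <-].
by apply: le_trans (ca i) _; apply: ereal_sup_ubound; exists i.
Qed.

Theorem theorem4p7 (R : realType) (X : completeNormedModType R) :
  super_reflexive X ->
  forall (C : set X), C !=set0 -> closed C -> bounded_set_norm C ->
    convex_set_R C ->
  forall (T : X -> X), cm_nonexpansive C T ->
    exists x, C x /\ T x = x.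
Proof.
move=> sX C C0 clC bC cC T [CT Tne Tcm].
have /choice[v vP] i : exists x, C x /\ `|T x - x| <= i.+1%:R^-1.
  have i0 : 0 < i.+1%:R^-1 :> R by rewrite invr_gt0.
  by have [x] := nonexpansive_approx_fixed_point C0 clC bC cC CT Tne i0; exists x.
have [M CM] := bC.
have vb : bounded_seq v by exists M => i; apply: CM; exact: (vP i).1.
have [x xP] := reflexive_weak_ulim (super_reflexive_reflexive sX) vb.
pose y i := v i - x; pose K := M + `|x|.
have yK i : `|y i| <= K.
  by apply: le_trans (ler_normB _ _) _; rewrite lerD2r; apply: CM; exact: (vP i).1.
have y0 f : bdd_lin f -> f (y i) @[i --> U] --> (0 : R).
  move=> fb; have [c [_ fD fZ _]] := fb; rewrite -(subrr (f x)).
  under eq_fun do rewrite /y fD -scaleN1r fZ mulN1r.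
  by apply: cvgB; [exact: xP|exact: cvg_cst].
have near_fixed e : 0 < e -> \forall k \near U, `|T (v k) - v k| <= e.
  move=> e0; have [n _ nP] := near_infty_natSinv_lt (PosNum e0).
  apply: filterS (free_ultrafilter_ge n) => k nk.
  by apply: le_trans (vP k).2 (ltW _); exact: nP.
have small theta : 0 < theta -> exists (u : nat -> nat) n,
    [/\ (0 < n)%N, forall i, `|T (v (u i)) - v (u i)| <= theta &
        forall (A : {set 'I_n}) i,
          `|\sum_(k in A) y (u (i + k.+1)%N)| <= n%:R * (theta + theta)].
  move=> theta0; have [N Nu] := super_reflexive_small_sums sX yK y0 theta0.
  have [u [uT uA]] := Nu _ (near_fixed _ theta0).
  (* Taking [n] above [N * K / theta] absorbs the term [N * K] into a second [n * theta]. *)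
  have [n [n0 nN]] : exists n : nat, (0 < n)%N /\ N%:R * K <= n%:R * theta.
    have q0 : 0 <= N%:R * K / theta.
      by apply: divr_ge0 (ltW theta0); apply: mulr_ge0 => //; exact: le_trans (yK 0).
    have nP := archi_boundP q0; exists (Num.bound (N%:R * K / theta)).
    by rewrite -(ltr_nat R) (le_lt_trans q0 nP) -ler_pdivrMr // ltW.
  exists u, n; split => // A i; apply: le_trans (uA n A i) _.
  by rewrite (mulrDr n%:R) lerD2r.
have Cx : C x.
  apply: clC => B /nbhs_normP[e /= e0 eB].
  (* A mean of selected [v] will lie within [2 * (e / 3) < e] of [x]. *)
  have e3 : 0 < e / 3 by rewrite divr_gt0.
  have [u [n [n0 _ uA]]] := small _ e3; case: n n0 uA => // n _ uA.
  pose z := n.+1%:R^-1 *: \sum_(k < n.+1) v (u (0 + k.+1)%N).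
  exists z; split.
    by apply: (@convex_set_mean _ _ C (fun k => v (u k.+1))) => // i; exact: (vP _).1.
  apply: eB; rewrite /= distrC.
  have -> : z - x = n.+1%:R^-1 *: \sum_(k in [set: 'I_n.+1]%SET) y (u (0 + k.+1)%N).
    under eq_bigl do rewrite finset.in_setT.
    rewrite sumrB sumr_const card_ord scalerBr -[x *+ _]scaler_nat scalerA.
    by rewrite mulVf ?pnatr_eq0 // scale1r.
  rewrite normrZ gtr0_norm ?invr_gt0 // ltr_pdivrMl //.
  by apply: le_lt_trans (uA _ _) _; rewrite ltr_pM2l //; lra.
exists x; split => //; apply/eqP; rewrite -subr_eq0 -normr_le0.
apply/ler_addgt0Pr => e e0; rewrite add0r.
(* The final estimate is [n * |T x - x| <= (2 + 1 + 2) * n * theta], from the sum of [y], the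
   approximate fixed points and the cm-inequality. *)
have e5 : 0 < e / 5 by rewrite divr_gt0.
have [u [n [n0 uT uA]]] := small _ e5.
set theta := e / 5 in e5 uT uA.
have cm_le : (limn_esup (fun i => (cm_quant n (T \o (v \o u)) (T x) i)%:E) <=
    (n%:R * (theta + theta))%:E)%E.
  apply: le_trans (Tcm n x (v \o u) Cx (fun i => (vP (u i)).1)) _.
  apply: limn_esup_le => i; rewrite lee_fin; apply: bigmax_le => [|A _].
    by rewrite mulr_ge0 //; lra.
  exact: uA.
have cm_ge i : n%:R * `|T x - x| - n%:R * (theta + theta) - n%:R * theta <=
    cm_quant n (T \o (v \o u)) (T x) i.
  (* The full index set is used: with [p] a selected term, [T x - x = (p - x) + (T p - p) - (T p - T
     x)] is summed over it. *)
  pose A := [set: 'I_n]%SET.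
  apply: le_trans (le_bigmax _ _ A) => /=.
  have sumE : (T x - x) *+ n = \sum_(k in A) y (u (i + k.+1)%N) +
      \sum_(k in A) (T (v (u (i + k.+1)%N)) - v (u (i + k.+1)%N)) -
      \sum_(k in A) (T (v (u (i + k.+1)%N)) - T x).
    rewrite -big_split -sumrB /= -[n in LHS]card_ord -cardsT -sumr_const.
    apply: eq_bigr => k _; rewrite /y; move: (v _) (T (v _)) => p q.
    rewrite opprB [RHS]addrC [p - x + _]addrC [q - p + _]addrA subrK.
    by rewrite addrA subrK.
  have := lexx `|(T x - x) *+ n|; rewrite {2}sumE normrMn mulr_natl.
  move=> /le_trans/(_ (ler_normB _ _)).
  have := ler_normD (\sum_(k in A) y (u (i + k.+1)%N))
      (\sum_(k in A) (T (v (u (i + k.+1)%N)) - v (u (i + k.+1)%N))).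
  have : `|\sum_(k in A) (T (v (u (i + k.+1)%N)) - v (u (i + k.+1)%N))| <=
      n%:R * theta.
    apply: le_trans (ler_norm_sum _ _ _) _.
    apply: (@le_trans _ _ (\sum_(k in A) theta)); first by apply: ler_sum.
    by rewrite sumr_const cardsT card_ord mulr_natl.
  have := uA A i; lra.
have : ((n%:R * `|T x - x| - n%:R * (theta + theta) - n%:R * theta)%:E <=
    (n%:R * (theta + theta))%:E)%E.
  by apply: le_trans cm_le; apply: le_limn_esup => i; rewrite lee_fin.
rewrite lee_fin -!mulrBr ler_pM2l ?ltr0n // /theta.
by move: `|T x - x| => r; lra.
Qed.
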